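(* Let $d\geqslant 1$ and let $\alpha_1,\ldots,\alpha_{d-1}$ be positive integers, $A=\mathrm{diag}(\alpha_1,\ldots,\alpha_{d-1})$, and for $n\geqslant1$ let $\Lambda=\mathrm{diag}(\alpha_1,\ldots,\alpha_{d-1},n)$. Let $\mu_1,\ldots,\mu_{\det(A)-1}$ be the non-zero eigenvalues (with multiplicity) of the Laplacian on $\mathbb{Z}^{d-1}/A\mathbb{Z}^{d-1}$, namely the numbers $2(d-1)-2\sum_{i=1}^{d-1}\cos(2\pi k_i/\alpha_i)$ for $(k_1,\ldots,k_{d-1})$ with $0\leqslant k_i\leqslant\alpha_i-1$ and $(k_1,\ldots,k_{d-1})\neq 0$. Then for every integer $n\geqslant1$, the number of spanning trees of the discrete torus $\mathbb{Z}^d/\Lambda\mathbb{Z}^d$ is \[ \tau(\mathbb{Z}^d/\Lambda\mathbb{Z}^d)=\frac{n}{\det(A)}\prod_{k=1}^{\det(A)-1}\Big(\big(\mu_k/2+1+\sqrt{\mu_k^2/4+\mu_k}\big)^n+\big(\mu_k/2+1-\sqrt{\mu_k^2/4+\mu_k}\big)^n-2\Big). \]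
   Context: For a diagonal positive integer matrix $M=\mathrm{diag}(m_1,\ldots,m_r)$, the discrete torus $\mathbb{Z}^r/M\mathbb{Z}^r$ is the graph whose vertices are the elements of the group $\mathbb{Z}^r/M\mathbb{Z}^r$, each vertex $x$ being joined to $x\pm e_i$ for $i=1,\ldots,r$ (nearest neighbours, counted with multiplicity so that the graph is $2r$-regular). Its combinatorial Laplacian $\Delta f(x)=\sum_{y\sim x}(f(x)-f(y))$ has eigenvalues $2r-2\sum_{i=1}^r\cos(2\pi k_i/m_i)$, $0\leqslant k_i\leqslant m_i-1$. $\tau(G)$ denotes the number of spanning trees of $G$, equal by the matrix tree theorem to $\frac{1}{|V(G)|}$ times the product of the non-zero Laplacian eigenvalues. *)

(* Defs.v *)
From HB Require Import structures.
From mathcomp Require Import all_boot all_order all_algebra.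
From mathcomp Require Import boolp reals trigo.

Set Implicit Arguments.
Unset Strict Implicit.
Unset Printing Implicit Defensive.

Import Order.TTheory GRing.Theory Num.Theory.

(* The orientation given by [src] and [tgt] is only a device for naming the two
   ends of an edge; loops and parallel edges are allowed. *)
Record multigraph := Multigraph {
  vertex : finType;
  edge : finType;
  src : edge -> vertex;
  tgt : edge -> vertex }.

Section Multigraph.
Variable G : multigraph.

(* An edge with a direction of traversal. A loop gives two darts at its vertex,
   so a sum over the darts leaving x is a sum over the neighbours of x with
   multiplicity, a loop counting twice. *)
Definition dart : finType := (edge G * bool)%type.
Definition dtail (a : dart) : vertex G := if a.2 then tgt a.1 else src a.1.
Definition dhead (a : dart) : vertex G := if a.2 then src a.1 else tgt a.1.

Definition adj (T : {set edge G}) : rel (vertex G) := fun x y =>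
  [exists a : dart, [&& a.1 \in T, dtail a == x & dhead a == y]].

Definition connected (T : {set edge G}) : Prop := forall x y, connect (adj T) x y.

(* A loop is a cycle of length 1 and two parallel edges form a cycle of
   length 2; going back and forth along one edge is not a cycle. *)
Definition is_cycle (T : {set edge G}) (c : seq dart) : bool :=
  [&& c != [::],
      all (fun a : dart => a.1 \in T) c,
      cycle (fun a b : dart => dhead a == dtail b) c,
      uniq [seq a.1 | a : dart <- c]
    & uniq [seq dtail a | a <- c]].

Definition acyclic (T : {set edge G}) : Prop := ~ exists c, is_cycle T c.

Definition spanning_tree (T : {set edge G}) : Prop := connected T /\ acyclic T.

Definition tau : nat := #|[pred T : {set edge G} | `[< spanning_tree T >]]|.

Local Open Scope ring_scope.

Definition laplacian (R : pzRingType) (f : vertex G -> R) (x : vertex G) : R :=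
  \sum_(a : dart | dtail a == x) (f x - f (dhead a)).

Definition laplacian_mx (R : pzRingType) : 'M[R]_#|vertex G| :=
  \matrix_(i, j) laplacian (fun z => (z == enum_val j)%:R) (enum_val i).

End Multigraph.

Section Torus.
Variables (r : nat) (m : 'I_r -> nat).

(* The elements of Z^r / diag(m) Z^r, as r-tuples of residues. *)
Definition torus_vertex : finType := {dffun forall i : 'I_r, 'I_(m i)}.

(* Translation by e_i; [ordS] is the successor modulo [m j]. *)
Definition torus_shift (i : 'I_r) (x : torus_vertex) : torus_vertex :=
  [ffun j => if j == i then ordS (x j) else x j].

(* One edge {x, x + e_i} for each pair (x, i): loops when m i = 1 and double
   edges when m i = 2, so that the graph is always 2r-regular. *)
Definition torus : multigraph :=
  @Multigraph torus_vertex (torus_vertex * 'I_r)%type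
    (fun e => e.1) (fun e => torus_shift e.2 e.1).

Definition torus_nonzero (k : torus_vertex) : bool := [exists i, (k i != 0 :> nat)].

Local Open Scope ring_scope.

Definition torus_eigenvalue (R : realType) (k : torus_vertex) : R :=
  2 * r%:R - 2 * \sum_(i < r) cos (2 * pi * (k i)%:R / (m i)%:R).

End Torus.

(* The diagonal (m_0, ..., m_(r-1), n). *)
Definition rcons_diag (r : nat) (m : 'I_r -> nat) (n : nat) : 'I_r.+1 -> nat :=
  fun i => oapp m n (unlift ord_max i).

(* Main.v *)
(* The Laplacian is a sum of rank-one matrices b_e^T b_e over the edges. Adding
   d^T d, for d the indicator of a root, and expanding the determinant by the
   Cauchy-Binet formula, a set of edges contributes the square of the determinant
   of its (integer, rooted) incidence matrix B: a cycle is a relation between the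
   rows of B, the indicator of a component missing the root is in its kernel, and
   for a spanning tree the indicators of the two sides of each edge give an
   integer inverse of B, so that det B = 1 or -1. Hence det (L + d^T d) is the
   number of spanning trees tau, and det (L + J) = N^2 tau for the all-ones J.

   The functions cos + sin of the phases sum_i 2 pi k_i x_i / m_i (the Hartley
   basis) simultaneously diagonalize L and J on a torus, without recourse to
   complex numbers; thus N tau is the product of the non-zero eigenvalues.

   The eigenvalues of the last torus are mu_k + 2 - 2 cos (2 pi j / n). If
   p + 1/p = mu + 2, such a number is |p - z^j|^2 / p for z = exp (2 i pi / n), and
   the product over j is (p^n - 1)^2 / p^n; for mu = 0 the product over j <> 0 is
   n^2. *)
Require Import Defs.
From HB Require Import structures.
From mathcomp Require Import all_boot all_order all_algebra.
From mathcomp Require Import boolp reals trigo.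
From mathcomp Require Import perm complex ring lra.

Set Implicit Arguments.
Unset Strict Implicit.
Unset Printing Implicit Defensive.

Import Order.TTheory GRing.Theory Num.Theory.
Local Open Scope ring_scope.

(** * Determinants of sums of rank-one matrices *)

Lemma big_option (V : nmodType) (I : finType) (F : option I -> V) :
  \sum_i F i = F None + \sum_i F (Some i).
Proof.
rewrite (bigD1 None) //=; congr (_ + _).
rewrite (reindex_omap Some id) => [|[i|]] //=.
by apply: eq_bigl => i; rewrite eqxx.
Qed.

Section SumOfRankOne.
Variables (R : comNzRingType) (E : finType) (n : nat) (u v : E -> 'rV[R]_n).

(** Row [i] of the sum is a combination of the [v e], so multilinearity expands the determinant over
    all choices [f] of one index per row. A choice that is not injective repeats a row and
    contributes 0. *)
Lemma det_sum_rank1_in (A : {set E}) :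
  \det (\sum_(e in A) (u e)^T *m v e) =
  \sum_(f in ffun_on (mem A) | injectiveb f)
    \prod_(i < n) u (f i) 0 i * \det (\matrix_(i < n) v (f i)).
Proof.
have -> : \det (\sum_(e in A) (u e)^T *m v e) =
    \sum_(f in ffun_on (mem A))
      \prod_(i < n) u (f i) 0 i * \det (\matrix_(i < n) v (f i)).
  rewrite /determinant.
  transitivity (\sum_(s : 'S_n) \sum_(f : {ffun 'I_n -> E} | f \in ffun_on (mem A))
      (-1) ^+ s * \prod_i (u (f i) 0 i * v (f i) 0 (s i))).
    apply: eq_bigr => s _; rewrite -mulr_sumr; congr (_ * _).
    rewrite -(bigA_distr_big (mem A)
                (fun i e => u e 0 i * v e 0 (s i))).
    apply: eq_bigr => i _; rewrite summxE; apply: eq_bigr => e _.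
    by rewrite !mxE big_ord1 !mxE.
  rewrite exchange_big /=; apply: eq_bigr => f _.
  rewrite mulr_sumr; apply: eq_bigr => s _.
  rewrite big_split /= mulrCA; congr (_ * (_ * _)).
  by apply: eq_bigr => i _; rewrite mxE.
rewrite (bigID (fun f : {ffun 'I_n -> E} => injectiveb f)) /=.
rewrite [X in _ + X]big1 ?addr0 // => f /andP[_ /injectivePn[i [j ij fij]]].
rewrite (determinant_alternate ij) ?mulr0 // => k.
by rewrite !mxE fij.
Qed.

(** Cauchy-Binet: the injective choices are grouped by their image [T], and the group of [T] is the
    same expansion carried out for [T] alone. *)
Lemma det_sum_rank1 :
  \det (\sum_e (u e)^T *m v e) =
  \sum_(T : {set E} | #|T| == n) \det (\sum_(e in T) (u e)^T *m v e).
Proof.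
have -> : \sum_e (u e)^T *m v e = \sum_(e in [set: E]) (u e)^T *m v e.
  by apply: eq_bigl => e; rewrite inE.
rewrite det_sum_rank1_in.
rewrite (partition_big (fun f : {ffun 'I_n -> E} => f @: setT)
           (fun T => #|T| == n)) /=; last first.
  move=> f /andP[_ /injectiveP injf].
  by rewrite card_imset // cardsT card_ord.
apply: eq_bigr => T /eqP cardT; rewrite det_sum_rank1_in.
apply: eq_bigl => f.
have -> : f \in ffun_on (mem [set: E]) by apply/ffun_onP => i; rewrite inE.
rewrite /= andbC.
case: (boolP (injectiveb f)) => [/injectiveP injf|_]; last by rewrite !andbF.
rewrite !andbT; apply/eqP/ffun_onP => [<- i|fT]; first exact: imset_f.
apply/eqP; rewrite eqEcard card_imset // cardsT card_ord cardT leqnn andbT.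
by apply/subsetP => _ /imsetP[i _ ->]; apply: fT.
Qed.

End SumOfRankOne.

(** The block matrix [A] has two triangular factorizations, one for each order of elimination;
    comparing their determinants gives the identity. *)
Lemma det_rank1_update (R : comNzRingType) n (x : 'cV[R]_n) (y : 'rV[R]_n) :
  \det (1%:M + x *m y) = 1 + (y *m x) 0 0.
Proof.
pose A := block_mx (1%:M : 'M[R]_1) (- y) x 1%:M.
have E1 : A = block_mx 1%:M 0 x 1%:M *m block_mx 1%:M (- y) 0 (1%:M + x *m y).
  rewrite mulmx_block !mulmx1 !mul1mx !mulmx0 ?mul0mx !addr0 mulmxN.
  by rewrite addrC addrK.
have E2 : A = block_mx (1%:M + y *m x) (- y) 0 1%:M *m block_mx 1%:M 0 x 1%:M.
  rewrite mulmx_block !mulmx1 !mulmx0 ?mul0mx ?mul1mx !add0r mulNmx addrK.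
  by rewrite ?mul1mx.
have : \det A = \det (1%:M + x *m y).
  by rewrite E1 det_mulmx det_lblock det_ublock !det1 !mul1r.
by rewrite E2 det_mulmx det_lblock det_ublock !det1 !mulr1 det_mx11 !mxE => <-.
Qed.

(** * Cycles and bridges *)

Section Cycles.
Variables (G : multigraph).
Implicit Types (T : {set edge G}) (x y : vertex G) (a b : dart G).

Lemma adj_sym T : symmetric (adj T).
Proof.
suff H x y : adj T x y -> adj T y x by move=> x y; apply/idP/idP; apply: H.
case/existsP => -[e b] /and3P[/= eT tx hy]; apply/existsP; exists (e, ~~ b).
by move: tx hy; rewrite /dtail /dhead /= eT; case: b => /= -> ->.
Qed.

Lemma connect_adj_sym T : connect_sym (adj T).
Proof. by apply: sym_connect_sym; apply: adj_sym. Qed.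

Lemma adj_edge T e : e \in T -> adj T (src e) (tgt e).
Proof.
by move=> eT; apply/existsP; exists (e, false); rewrite /dtail /dhead /= eT !eqxx.
Qed.

Lemma adj_invariant (A : Type) T (f : vertex G -> A) :
  (forall e, e \in T -> f (src e) = f (tgt e)) ->
  forall x y, connect (adj T) x y -> f x = f y.
Proof.
move=> fT x y /connectP[p pP ->]; elim: p x pP => //= z p IH x /andP[xz /IH <-].
case/existsP: xz => -[e b] /and3P[/= eT /eqP <- /eqP <-].
by rewrite /dtail /dhead /=; case: b; rewrite fT.
Qed.

(** Expressing the chain condition through the lists of heads and tails lets it be read off from the
    vertices visited. *)
Lemma path_dart_linkE a (c : seq (dart G)) :
  path (fun a b => dhead a == dtail b) a c =
  ([seq dtail b | b <- c] == belast (dhead a) [seq dhead b | b <- c]).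
Proof. by elim: c a => //= b c IH a; rewrite IH eqseq_cons eq_sym. Qed.

Lemma path_adj_darts T x p :
  path (adj T) x p -> uniq (x :: p) ->
  exists c : seq (dart G),
    [/\ all (fun a : dart G => a.1 \in T) c, [seq dtail a | a <- c] = belast x p,
        [seq dhead a | a <- c] = p & uniq [seq a.1 | a : dart G <- c]].
Proof.
elim: p x => [|y p IH] x /=; first by move=> _ _; exists [::].
case/andP=> /existsP[a /and3P[aT /eqP ta /eqP ha]] pp /andP[xp up].
have [c [cT tc hc uc]] := IH y pp up.
exists (a :: c) => /=; rewrite aT cT ta tc ha hc uc andbT; split=> //.
(* If the first edge reappeared in [c], in either direction, both its ends would lie on the rest of
   the path; but one of them is [x]. *)
apply/andP; split=> //; apply/mapP => -[b bc ab]; move: xp.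
have tb : dtail b \in y :: p.
  by apply: mem_belast; rewrite -tc; apply: map_f.
have hb : dhead b \in y :: p by rewrite inE -hc map_f ?orbT.
move/negP; apply; rewrite -ta.
case: a b ab tb hb {ta ha aT bc} => [e i] [e' j] /= <-.
by case: i; case: j; rewrite /dtail /dhead.
Qed.

(** A simple path from [tgt e] back to [src e] avoiding [e] would close up with [e] into a cycle. *)
Lemma acyclic_bridge T e :
  acyclic T -> e \in T -> ~~ connect (adj (T :\ e)) (src e) (tgt e).
Proof.
move=> acT eT; rewrite connect_adj_sym; apply/negP => /connectP[p0 pp0 lp0].
case: (shortenP pp0) lp0 => p pp up _ lp {p0 pp0}.
have [c [cT tc hc uc]] := path_adj_darts pp up.
pose a : dart G := (e, false).
apply: acT; exists (a :: c); apply/and5P; split => //=.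
- rewrite eT /=; apply: sub_all cT => b; by rewrite inE => /andP[].
- rewrite path_dart_linkE !map_rcons tc hc belast_rcons.
  by rewrite lastI /dtail /dhead /= lp.
- rewrite uc andbT; apply/mapP => -[b bc eb].
  by move/allP: cT => /(_ b bc); rewrite in_setD1 -eb /= eqxx.
rewrite tc -(rcons_uniq) /dtail /= lp.
by rewrite -lastI.
Qed.

(** Along a closed walk the list of tails is a rotation of the list of heads. *)
Lemma cycle_telescope (V : nmodType) (f : vertex G -> V) (c : seq (dart G)) :
  cycle (fun a b => dhead a == dtail b) c ->
  \sum_(a <- c) f (dhead a) = \sum_(a <- c) f (dtail a).
Proof.
case: c => [|a c]; first by rewrite !big_nil.
rewrite /= path_dart_linkE !map_rcons belast_rcons => /eqP H.
rewrite -(big_map (@dhead G) xpredT f) -(big_map (@dtail G) xpredT f) /= -H.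
by rewrite -cats1 big_cat /= big_seq1 addrC big_cons.
Qed.

End Cycles.

(** * The matrix-tree theorem *)

Section MatrixTree.
Variables (G : multigraph) (v : vertex G).
Local Notation N := #|vertex G|.
Implicit Types (T : {set edge G}).

(* The boundary of an edge, [None] standing for an extra half-edge at the root. *)
Definition boundary (R : pzRingType) (e : option (edge G)) (x : vertex G) : R :=
  if e is Some e then (x == src e)%:R - (x == tgt e)%:R else (x == v)%:R.

Definition boundary_mx (R : pzRingType) m (h : 'I_m -> option (edge G)) :
    'M[R]_(m, N) :=
  \matrix_(i, j) boundary R (h i) (enum_val j).

Lemma sum_delta (R : pzRingType) (f : vertex G -> R) (y : vertex G) :
  \sum_x (x == y)%:R * f x = f y.
Proof.
rewrite (bigD1 y) //= eqxx mul1r big1 ?addr0 // => x /negPf ->.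
by rewrite mul0r.
Qed.

Lemma sum_boundary (R : pzRingType) (f : vertex G -> R) (e : option (edge G)) :
  \sum_x boundary R e x * f x =
  if e is Some e then f (src e) - f (tgt e) else f v.
Proof.
case: e => [e|] /=; last exact: sum_delta.
under eq_bigr do rewrite mulrBl.
by rewrite sumrB !sum_delta.
Qed.

Lemma sum_enum_val (V : nmodType) (f : vertex G -> V) :
  \sum_(j < N) f (enum_val j) = \sum_x f x.
Proof. by rewrite -big_enum_val; apply: eq_bigl => x; rewrite inE. Qed.

Lemma boundary_mx_mul (R : pzRingType) m k (h : 'I_m -> option (edge G))
    (g : 'I_k -> vertex G -> R) i l :
  (boundary_mx R h *m \matrix_(j, l) g l (enum_val j)) i l =
  if h i is Some e then g l (src e) - g l (tgt e) else g l v.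
Proof.
rewrite mxE -(sum_boundary (g l)) -sum_enum_val.
by apply: eq_bigr => j _; rewrite !mxE.
Qed.

(** The family dual to the boundaries: the indicator of the side of [src e] once [e] is removed,
    shifted by a constant so as to vanish at the root. The constant 1 is dual to the root
    half-edge. *)
Definition bridge_potential (R : pzRingType) T (e : option (edge G))
    (x : vertex G) : R :=
  if e is Some e
  then (connect (adj (T :\ e)) (src e) x)%:R - (connect (adj (T :\ e)) (src e) v)%:R
  else 1.

Lemma boundary_mx_right_inverse (R : pzRingType) m (h : 'I_m -> option (edge G)) T :
  injective h -> acyclic T ->
  (forall i e, h i = Some e -> e \in T) ->
  boundary_mx R h *m \matrix_(j, l) bridge_potential R T (h l) (enum_val j) = 1%:M.
Proof.
move=> injh acT hT; apply/matrixP => i l.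
rewrite (boundary_mx_mul h (fun l => bridge_potential R T (h l))) mxE -(inj_eq injh i l).
case hi: (h i) => [e|]; case hl: (h l) => [e'|] //=; last 2 first.
- by rewrite subrr.
- by rewrite subrr.
have -> : (Some e == Some e') = (e == e') by [].
(* Across its own edge the potential drops from 1 to 0, since that edge is a bridge; any other edge
   of [T] has both ends on the same side. *)
rewrite opprB addrA subrK; case: eqVneq => [->|ee'].
  rewrite connect0 (negPf (acyclic_bridge acT _)) ?subr0 //.
  exact: hT hl.
apply/eqP; rewrite subr_eq0; apply/eqP; congr (nat_of_bool _)%:R.
apply: same_connect_r; first exact: connect_adj_sym.
by apply/connect1/adj_edge; rewrite !inE ee' (hT _ _ hi).
Qed.

(** A function killed by all boundaries is constant along edges and zero at the root, hence zero by
    connectedness. The boundaries thus have rank [N]; the rationals serve as a field in which to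
    speak of rank. *)
Lemma connected_card_vertex_le (m : nat) (h : 'I_m -> option (edge G)) T :
  connected T -> (forall e, e \in T -> exists i, h i = Some e) ->
  (exists i, h i = None) -> (N <= m)%N.
Proof.
move=> conT hT [i0 hi0].
suff /eqP <- : row_free (boundary_mx rat h)^T by rewrite rank_leq_col.
apply: inj_row_free => w /(congr1 trmx); rewrite trmx_mul trmxK trmx0 => Bw.
pose f x := w 0 (enum_rank x).
have Bf i : (if h i is Some e then f (src e) - f (tgt e) else f v) = 0.
  have := boundary_mx_mul h (fun _ : 'I_1 => f) i 0.
  move=> <-; rewrite [X in _ *m X](_ : _ = w^T) ?Bw ?mxE //.
  by apply/matrixP => j l; rewrite !mxE /f enum_valK ord1.
have fv : f v = 0 by have := Bf i0; rewrite hi0.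
have fx x : f x = 0.
  rewrite -fv; apply: (adj_invariant _ (conT x v)) => e /hT[i hi].
  by apply/eqP; rewrite -subr_eq0; have := Bf i; rewrite hi => ->.
by apply/rowP => j; rewrite mxE -[j]enum_valK -/(f _).
Qed.

Lemma det_boundary_mx_eq0 (h : 'I_N -> option (edge G)) (f : vertex G -> int) x :
  f x != 0 -> (forall i, (if h i is Some e then f (src e) - f (tgt e) else f v) = 0) ->
  \det (boundary_mx int h) = 0.
Proof.
move=> fx0 hf; apply/eqP; rewrite -det_tr; apply/det0P.
exists (\row_j f (enum_val j)).
  by apply: contraNneq fx0 => /rowP/(_ (enum_rank x)); rewrite !mxE enum_rankK => ->.
apply: trmx_inj; rewrite trmx_mul trmxK trmx0; apply/matrixP => i l.
rewrite [RHS]mxE -(hf i) -(boundary_mx_mul h (fun _ : 'I_1 => f) i l).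
by rewrite 2!mxE; apply: eq_bigr => j _; rewrite !mxE.
Qed.

Lemma det_boundary_mx_cycle (h : 'I_N -> option (edge G)) T (c : seq (dart G)) :
  injective h -> (forall e, e \in T -> exists i, h i = Some e) ->
  is_cycle T c -> \det (boundary_mx int h) = 0.
Proof.
move=> injh hT /and5P[c0 /allP cT cc uc _]; apply/eqP/det0P.
(* The sign records whether the cycle traverses the edge along or against its orientation. As no
   edge repeats, each edge of the cycle has coefficient 1 or -1, so [w] is nonzero. *)
pose w : 'rV[int]_N := \row_i \sum_(a <- c | h i == Some a.1) (-1) ^+ a.2.
exists w.
  case: c c0 cT uc {cc} @w => // a c _ cT /= /andP[ac _].
  have [i hi] := hT _ (cT a (mem_head _ _)).
  apply/negP => /eqP/rowP/(_ i)/eqP; rewrite !mxE big_cons hi eqxx big_seq_cond.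
  rewrite big_pred0 ?addr0 ?signr_eq0 // => b.
  apply/negP => /andP[bc /eqP[ab]]; move/negP: ac; apply; rewrite ab.
  by apply: (map_f (fun a : dart G => a.1)).
apply/rowP => j; rewrite !mxE; set x := enum_val j.
transitivity (\sum_(a <- c) \sum_(i | h i == Some a.1)
                (-1) ^+ a.2 * boundary int (Some a.1) x).
  rewrite (exchange_big_dep xpredT) //=; apply: eq_bigr => i _.
  rewrite !mxE mulr_suml; apply: eq_bigr => a /eqP ->.
  by [].
transitivity (\sum_(a <- c) ((x == dtail a)%:R - (x == dhead a)%:R : int)).
  rewrite big_seq [RHS]big_seq; apply: eq_bigr => a /cT /hT[i hi].
  rewrite (big_pred1 i) => [|i']; last by rewrite -hi (inj_eq injh).
  by rewrite /dtail /dhead /=; case: a.2; rewrite ?mul1r // mulN1r opprB.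
by rewrite sumrB -(cycle_telescope (fun y => (x == y)%:R : int) cc) subrr.
Qed.

Lemma det_boundary_mx_sqr (h : 'I_N -> option (edge G)) T :
  injective h -> (exists i, h i = None) ->
  (forall e, e \in T <-> exists i, h i = Some e) ->
  \det (boundary_mx int h) ^+ 2 = `[< spanning_tree T >]%:R.
Proof.
move=> injh hN hT; case: asboolP => [[_ acT]|nT].
  have hT' i e : h i = Some e -> e \in T by move=> hi; apply/hT; exists i.
  have /(congr1 determinant) := boundary_mx_right_inverse int injh acT hT'.
  rewrite det_mulmx det1 => detBD.
  (* Working over the integers matters here: their only units are 1 and -1, whose squares are 1. *)
  have : \det (boundary_mx int h) \is a GRing.unit.
    by apply/unitrPr; eexists; apply: detBD.
  by rewrite qualifE /= => /orP[]/eqP ->.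
apply/eqP; rewrite sqrf_eq0; apply/eqP.
have [conT|] := pselect (connected T).
  have [acT|/contrapT[c cT]] := pselect (acyclic T); first by case: nT.
  by apply: det_boundary_mx_cycle cT => // e /hT.
move=> /existsNP[x /existsNP[y /negP nxy]].
(* Of two vertices that are not connected, at least one is cut off from the root; the indicator of
   its component is then in the kernel. *)
have [z nz] : exists z, ~~ connect (adj T) z v.
  have [xv|] := boolP (connect (adj T) x v); last by exists x.
  exists y; apply: contra nxy => yv; apply: connect_trans xv _.
  by rewrite connect_adj_sym.
apply: (@det_boundary_mx_eq0 h (fun x => (connect (adj T) z x)%:R) z).
  by rewrite connect0.
move=> i; case hi: (h i) => [e|]; last by rewrite (negPf nz).
apply/eqP; rewrite subr_eq0; apply/eqP; congr (nat_of_bool _)%:R.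
apply: same_connect_r; first exact: connect_adj_sym.
by apply/connect1/adj_edge/hT; exists i.
Qed.

Definition root_mx (R : pzRingType) : 'rV[R]_N := \row_j (enum_val j == v)%:R.

(** The two darts of an edge contribute to the rows of its two ends, together giving the rank-one
    term of its boundary; a loop gives 0 on both sides. The index [None] accounts for the root
    term. *)
Lemma laplacian_root_mxE (R : comNzRingType) :
  laplacian_mx G R + (root_mx R)^T *m root_mx R =
  \sum_(e : option (edge G))
    (\row_j boundary R e (enum_val j))^T *m (\row_j boundary R e (enum_val j)).
Proof.
apply/matrixP => i j; rewrite [LHS]mxE summxE big_option addrC; congr (_ + _).
rewrite mxE /laplacian big_mkcond /=.
rewrite -(pair_big xpredT xpredT (fun e b => if dtail ((e, b) : dart G) == enum_val i
   then (enum_val i == enum_val j)%:R - (dhead ((e, b) : dart G) == enum_val j)%:R else 0)) /=.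
apply: eq_bigr => e _; rewrite big_bool !mxE big_ord1 !mxE /dtail /dhead /=.
move: (enum_val i) (enum_val j) (src e) (tgt e) => x y s t.
rewrite !(eq_sym x) !(eq_sym _ y).
by case: (eqVneq t x) => [->|_]; case: (eqVneq s x) => [->|_] /=; ring.
Qed.

Lemma matrix_tree :
  \det (laplacian_mx G int + (root_mx int)^T *m root_mx int) = (tau G)%:R.
Proof.
rewrite laplacian_root_mxE det_sum_rank1.
transitivity (\sum_(S : {set option (edge G)} | #|S| == N)
   ((None \in S) && `[< spanning_tree (Some @^-1: S) >])%:R : int).
  apply: eq_bigr => S /eqP cardS.
  have [h injh hS] : exists2 h : 'I_N -> option (edge G),
      injective h & S = h @: setT.
    pose h i := enum_val (cast_ord (esym cardS) i).
    have injh : injective h by move=> i j /enum_val_inj/cast_ord_inj.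
    exists h => //; apply/esym/eqP.
    rewrite eqEcard card_imset // cardsT card_ord cardS leqnn andbT.
    by apply/subsetP => _ /imsetP[i _ ->]; apply: enum_valP.
  have -> : \sum_(e in S)
      (\row_j boundary int e (enum_val j))^T *m (\row_j boundary int e (enum_val j))
      = (boundary_mx int h)^T *m boundary_mx int h.
    rewrite hS big_imset /=; last by move=> ? ? _ _ /injh.
    apply/matrixP => i j; rewrite summxE mxE.
    apply: eq_big => [k|k _]; first by rewrite inE.
    by rewrite !mxE big_ord1 !mxE.
  rewrite det_mulmx det_tr -expr2.
  have mem_S e : e \in S <-> exists i, h i = e.
    rewrite hS; split => [/imsetP[i _ ->]|[i <-]]; first by exists i.
    exact: imset_f.
  case: (boolP (None \in S)) => [|NS] /=.
    move=> /mem_S hN; apply: det_boundary_mx_sqr => // e.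
    by rewrite inE; apply: mem_S.
  (* Without the root half-edge, every boundary kills the constant functions. *)
  rewrite (@det_boundary_mx_eq0 h (fun=> 1) v) ?expr0n // => i.
  case hi: (h i) => [e|]; rewrite ?subrr //.
  by case/negP: NS; apply/mem_S; exists i.
rewrite -natr_sum; congr _%:R; rewrite /tau -[RHS]sum1_card.
pose add_root (T : {set edge G}) := None |: Some @: T.
have add_rootK T : Some @^-1: add_root T = T.
  by apply/setP => e; rewrite !inE mem_imset // => ? ? [].
have card_add_root T : #|add_root T| = #|T|.+1.
  rewrite cardsU1 card_imset; last by move=> ? ? [].
  by rewrite (_ : None \notin _) //; apply/imsetP => -[].
(* Acyclicity bounds the size from above through the right inverse, connectedness from below through
   the rank; the extra 1 is the root half-edge. *)
have card_tree T : spanning_tree T -> #|T|.+1 = N.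
  move=> [conT acT]; pose h (i : 'I_#|add_root T|) := enum_val i.
  have mem_h e : e \in add_root T -> exists i, h i = e.
    by move=> eT; exists (enum_rank_in eT e); apply: enum_rankK_in.
  rewrite -card_add_root; apply/eqP; rewrite eqn_leq; apply/andP; split.
    apply: (mulmx1_min (boundary_mx_right_inverse int (@enum_val_inj _ _) acT _)).
    move=> i e ie; have := enum_valP i; rewrite ie !inE /= mem_imset //.
    by move=> ? ? [].
  apply: (@connected_card_vertex_le _ h T) => //.
    by move=> e eT; apply: mem_h; rewrite !inE /= imset_f.
  by apply: mem_h; rewrite !inE.
rewrite [RHS](eq_bigr (fun T => (`[< spanning_tree T >] : nat))); last first.
  by move=> T; rewrite inE => ->.
rewrite (bigID (fun S : {set option (edge G)} => None \in S)) /=.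
rewrite [X in (_ + X)%N]big1 ?addn0; last by move=> S /andP[_ /negPf ->].
rewrite (reindex_onto add_root (fun S => Some @^-1: S)) /=; last first.
  move=> S /andP[_ NS]; apply/setP => -[e|]; rewrite !inE ?NS //.
  by rewrite mem_imset ?inE // => ? ? [].
rewrite big_mkcond [RHS]big_mkcond; apply: eq_bigr => T _ /=.
rewrite add_rootK eqxx card_add_root !inE eqxx /= !andbT.
by case: asboolP => [/card_tree ->|_]; rewrite ?eqxx //; case: ifP.
Qed.

End MatrixTree.

(** * The matrix-tree theorem with the all-ones matrix *)

Section LaplacianPlusOnes.
Variables (R : comNzRingType) (G : multigraph) (v : vertex G).
Local Notation N := #|vertex G|.
Local Notation L := (laplacian_mx G R).
Local Notation d := (root_mx v R).
Local Notation u := (const_mx 1 : 'rV[R]_N).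

Lemma tr_laplacian_mx : L^T = L.
Proof.
apply: (addIr (d^T *m d)); rewrite -[in LHS](trmxK (d^T *m d)) -linearD /=.
rewrite trmx_mul trmxK laplacian_root_mxE linear_sum /=.
by apply: eq_bigr => e _; rewrite trmx_mul trmxK.
Qed.

Lemma laplacian_mx_ones : L *m u^T = 0.
Proof.
apply/matrixP => i k; rewrite !mxE.
under eq_bigr do rewrite !mxE mulr1.
rewrite exchange_big big1 // => a _; rewrite sumrB.
rewrite (sum_enum_val (fun y => (enum_val i == y)%:R)).
rewrite (sum_enum_val (fun y => (dhead a == y)%:R)).
under eq_bigr do rewrite eq_sym -[_%:R]mulr1.
rewrite sum_delta; under eq_bigr do rewrite eq_sym -[_%:R]mulr1.
by rewrite sum_delta subrr.
Qed.

(* With [d] the indicator of the root and [P = 1 + u^T (u - d)] one has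
   [L P = L] and [d P = u], while [det P = N]. *)
Lemma det_laplacian_ones :
  \det (L + u^T *m u) = N%:R ^+ 2 * \det (L + d^T *m d).
Proof.
have du : d *m u^T = 1%:M.
  apply/matrixP => i k; rewrite !ord1 !mxE eqxx /=.
  under eq_bigr do rewrite !mxE.
  by rewrite (sum_enum_val (fun x => (x == v)%:R * 1)) sum_delta.
pose P : 'M[R]_N := 1%:M + u^T *m (u - d).
have LP : L *m P = L by rewrite mulmxDr mulmx1 mulmxA laplacian_mx_ones mul0mx addr0.
have PL : P^T *m L = L by rewrite -{1}tr_laplacian_mx -trmx_mul LP tr_laplacian_mx.
have dP : d *m P = u by rewrite mulmxDr mulmx1 mulmxA du mul1mx addrC subrK.
have detP : \det P = N%:R.
  rewrite det_rank1_update mulmxBl du !mxE.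
  rewrite eqxx addrCA subrr addr0.
  under eq_bigr do rewrite !mxE mulr1.
  by rewrite sumr_const card_ord.
have <- : P^T *m (L + d^T *m d) *m P = L + u^T *m u.
  by rewrite (mulmxDr P^T) mulmxDl PL LP mulmxA -trmx_mul dP -mulmxA dP.
by rewrite !det_mulmx det_tr detP mulrC mulrA expr2.
Qed.

Lemma matrix_tree_ones : \det (L + u^T *m u) = N%:R ^+ 2 * (tau G)%:R.
Proof.
rewrite det_laplacian_ones; congr (_ * _).
have -> : (tau G)%:R = (tau G)%:R%:~R :> R by rewrite rmorph_nat.
rewrite -(matrix_tree v) -det_map_mx; congr determinant.
apply/matrixP => i j; rewrite !mxE !big_ord1 !mxE rmorphD rmorphM !rmorph_nat; congr (_ + _).
by rewrite /laplacian rmorph_sum; apply: eq_bigr => a _; rewrite rmorphB !rmorph_nat.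
Qed.

End LaplacianPlusOnes.

(** * Diagonalization of the Laplacian of a torus *)

(** Instead of inverting [H], both sides are multiplied by its determinant, a nonzero constant
    polynomial. *)
Lemma char_poly_diagonalized (F : fieldType) n (A H : 'M[F]_n) (d : 'rV[F]_n) :
  A *m H = H *m diag_mx d -> \det H != 0 ->
  char_poly A = \prod_i ('X - (d 0 i)%:P).
Proof.
move=> AH detH; transitivity (char_poly (diag_mx d)); last first.
  rewrite char_poly_trig ?diag_mx_is_trig //.
  by apply: eq_bigr => i _; rewrite mxE eqxx.
apply: (@mulIf _ (\det (map_mx polyC H))); first by rewrite det_map_mx polyC_eq0.
rewrite [RHS]mulrC -!det_mulmx; congr determinant.
by rewrite /char_poly_mx mulmxBl mulmxBr -!map_mxM AH scalar_mxC.
Qed.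

Lemma det_diagonalized (F : fieldType) n (A H : 'M[F]_n) (d : 'rV[F]_n) :
  A *m H = H *m diag_mx d -> \det H != 0 -> \det A = \prod_i d 0 i.
Proof.
move=> AH detH; apply: (mulIf detH); rewrite -det_mulmx AH det_mulmx det_diag.
exact: mulrC.
Qed.

Lemma laplacian_mx_mul (R : comNzRingType) (G : multigraph) k
    (g : 'I_k -> vertex G -> R) i l :
  (laplacian_mx G R *m \matrix_(j, l) g l (enum_val j)) i l =
  laplacian (g l) (enum_val i).
Proof.
rewrite mxE; under eq_bigr do rewrite !mxE mulr_suml.
rewrite exchange_big; apply: eq_bigr => a _ /=.
transitivity (\sum_y (((y == enum_val i)%:R * g l y) - ((y == dhead a)%:R * g l y))).
  rewrite -sum_enum_val; apply: eq_bigr => j _.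
  by rewrite mulrBl ![_ == enum_val j]eq_sym.
by rewrite sumrB !sum_delta.
Qed.

(** * Angles modulo full turns *)

Section FullTurn.
Variable R : realType.
Implicit Types x y : R.

Definition full_turn y := cos y = 1 /\ sin y = 0.

Lemma full_turnD x y : full_turn x -> full_turn y -> full_turn (x + y).
Proof.
move=> [cx sx] [cy sy]; rewrite /full_turn cosD sinD cx sx cy sy.
by rewrite !mulr0 mul0r mulr1 subr0 addr0.
Qed.

Lemma full_turn0 : full_turn 0.
Proof. by rewrite /full_turn cos0 sin0. Qed.

Lemma full_turnN y : full_turn y -> full_turn (- y).
Proof. by move=> [cy sy]; rewrite /full_turn cosN sinN cy sy oppr0. Qed.

Lemma full_turnMn y n : full_turn y -> full_turn (y * n%:R).
Proof.
move=> fy; elim: n => [|n IH]; first by rewrite mulr0; apply: full_turn0.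
by rewrite -natr1 mulrDr mulr1; apply: full_turnD.
Qed.

Lemma full_turn2pi : full_turn (2 * pi).
Proof. by rewrite /full_turn mulr_natl cos2pi sin2pi. Qed.

Lemma cos_full_turn x y : full_turn (x - y) -> cos x = cos y.
Proof. by move=> [c s]; rewrite -(subrK y x) cosD c s mul1r mul0r subr0. Qed.

Lemma sin_full_turn x y : full_turn (x - y) -> sin x = sin y.
Proof. by move=> [c s]; rewrite -(subrK y x) sinD c s mul1r mul0r add0r. Qed.

(** Half-angle formula: [cos y] is 1 minus twice the square of [sin (y / 2)], which is positive. *)
Lemma cos_lt1 y : 0 < y -> y < 2 * pi -> cos y < 1.
Proof.
move=> y0 ypi; have yE : y = y / 2 + y / 2 by lra.
have s0 : 0 < sin (y / 2) by apply: sin_gt0_pi; apply/andP; split; lra.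
have := cos2Dsin2 (y / 2); have := cosD (y / 2) (y / 2); rewrite -yE => ->; nra.
Qed.

Lemma cos_frac_neq1 (a b n : nat) : (a < n)%N -> (b < n)%N -> a != b ->
  cos (2 * pi * a%:R / n%:R - 2 * pi * b%:R / n%:R) != 1 :> R.
Proof.
wlog ba : a b / (b < a)%N.
  move=> H an bn; rewrite neq_ltn => /orP[] ab; last by apply: H; rewrite // gtn_eqF.
  by rewrite -cosN opprB; apply: H; rewrite // gtn_eqF.
move=> an _ _; rewrite lt_eqF //; apply: cos_lt1.
  rewrite subr_gt0 ltr_pM2r ?invr_gt0 ?ltr0n ?(leq_trans _ an) //.
  by rewrite ltr_pM2l ?ltr_nat // mulr_gt0 ?pi_gt0.
have n0 : 0 < n%:R :> R by rewrite ltr0n (leq_trans _ an).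
rewrite -mulrBl -mulrBr ltr_pdivrMr // ltr_pM2l ?mulr_gt0 ?pi_gt0 //.
rewrite ltrBlDr; apply: lt_le_trans (_ : n%:R <= _); first by rewrite ltr_nat.
by rewrite lerDl.
Qed.

Definition cas x := cos x + sin x.

Lemma cas_full_turn x y : full_turn (x - y) -> cas x = cas y.
Proof. by move=> fxy; rewrite /cas (cos_full_turn fxy) (sin_full_turn fxy). Qed.

Lemma casM x y : cas x * cas y = cos (x - y) + sin (x + y).
Proof. rewrite /cas cosB sinD; ring. Qed.

End FullTurn.

(** * The Hartley eigenbasis of a torus *)

Section Torus.
Variables (R : realType) (r : nat) (m : 'I_r -> nat).
Local Notation V := (torus_vertex m).
Local Notation L := (laplacian_mx (torus m) R).
Implicit Types (x y k l : V) (phi psi : 'I_r -> R).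

Lemma torus_shift_inj (i : 'I_r) : injective (@torus_shift r m i).
Proof.
move=> x y /ffunP xy; apply/ffunP => j; have := xy j; rewrite !ffunE.
by case: (j == i) => // /(bij_inj (@ordS_bij _)).
Qed.

Lemma laplacian_torus (A : pzRingType) (f : V -> A) x :
  @laplacian (torus m) A f x =
  \sum_i ((f x - f (torus_shift i x)) + \sum_(y | torus_shift i y == x) (f x - f y)).
Proof.
rewrite /laplacian big_mkcond /=.
rewrite -(pair_big xpredT xpredT (fun e b => if dtail ((e, b) : dart (torus m)) == x
   then f x - f (dhead ((e, b) : dart (torus m))) else 0)) /=.
rewrite -(pair_big xpredT xpredT (fun y i => \sum_(b : bool)
   if dtail (((y, i), b) : dart (torus m)) == x
   then f x - f (dhead (((y, i), b) : dart (torus m))) else 0)) /=.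
rewrite exchange_big; apply: eq_bigr => i _ /=.
under eq_bigr do rewrite big_bool /dtail /dhead /=.
rewrite big_split /= addrC; congr (_ + _); last by rewrite -big_mkcond.
by rewrite -big_mkcond big_pred1_eq.
Qed.

(** The condition for the linear phase, computed on representatives, to be well defined on residues
    up to full turns. *)
Definition closed_phase phi := forall i, full_turn (phi i * (m i)%:R).

Definition phase phi x : R := \sum_i phi i * (x i)%:R.

Lemma phase_shift phi i x : closed_phase phi ->
  full_turn (phase phi (torus_shift i x) - (phase phi x + phi i)).
Proof.
move=> cphi; rewrite /phase (bigD1 i) //= [in X in _ - X](bigD1 i) //= ffunE eqxx.
rewrite [X in _ + X - _](eq_bigr (fun j => phi j * (x j)%:R)); last first.
  by move=> j /negPf ji; rewrite ffunE ji.
set S := \sum_(_ | _) _.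
have -> : phi i * (ordS (x i))%:R + S - (phi i * (x i)%:R + S + phi i) =
  phi i * (ordS (x i))%:R - phi i * (x i).+1%:R by rewrite -natr1; ring.
have := ltn_ord (x i); rewrite leq_eqVlt /= => /orP[/eqP xm|xm].
  by rewrite xm modnn mulr0 sub0r; apply/full_turnN/cphi.
by rewrite modn_small // subrr; apply: full_turn0.
Qed.

(** In each direction the two neighbours shift the phase by [phi i] and [- phi i], and [cas (t + s)
    + cas (t - s) = 2 * cos s * cas t]. *)
Lemma laplacian_cas phi x : closed_phase phi ->
  @laplacian (torus m) R (fun y => cas (phase phi y)) x =
  (2 * r%:R - 2 * \sum_i cos (phi i)) * cas (phase phi x).
Proof.
move=> cphi; rewrite laplacian_torus.
transitivity (\sum_(i < r) (2 - 2 * cos (phi i)) * cas (phase phi x)).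
  apply: eq_bigr => i _.
  rewrite (cas_full_turn (phase_shift i x cphi)).
  have [g gK Kg] := injF_bij (@torus_shift_inj i).
  rewrite (big_pred1 (g x)); last by move=> y /=; rewrite (can2_eq gK Kg).
  have := phase_shift i (g x) cphi; rewrite Kg => fg.
  have /cas_full_turn -> : full_turn (phase phi (g x) - (phase phi x - phi i)).
    by rewrite -[X in full_turn X]opprK; apply: full_turnN; congr full_turn: fg; ring.
  rewrite /cas !cosD !sinD cosN sinN; ring.
rewrite -mulr_suml sumrB -mulr_sumr sumr_const card_ord; congr ((_ - _) * _).
by rewrite mulr_natr.
Qed.

(** Translation by e_i permutes the vertices, so the vector [(C, S)] is fixed by the rotation of
    angle [phi i]. The identity minus this rotation has determinant [2 * (1 - c)], which is
    nonzero. *)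
Lemma sum_cos_sin_phase phi i : closed_phase phi -> cos (phi i) != 1 ->
  \sum_x cos (phase phi x) = 0 /\ \sum_x sin (phase phi x) = 0.
Proof.
move=> cphi c1; set C := \sum_x _; set S := \sum_x _.
have EC : C = cos (phi i) * C - sin (phi i) * S.
  rewrite {1}/C (reindex_inj (@torus_shift_inj i)) /= !mulr_sumr -sumrB.
  by apply: eq_bigr => x _; rewrite (cos_full_turn (phase_shift i x cphi)) cosD; ring.
have ES : S = sin (phi i) * C + cos (phi i) * S.
  rewrite {1}/S (reindex_inj (@torus_shift_inj i)) /= !mulr_sumr -big_split.
  by apply: eq_bigr => x _; rewrite (sin_full_turn (phase_shift i x cphi)) sinD /=; ring.
have cs := cos2Dsin2 (phi i).
move: c1 EC ES cs; set c := cos _; set s := sin _ => c1 EC ES cs.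
have c1' : 2 * (1 - c) != 0 
    by apply: mulf_neq0; rewrite ?pnatr_eq0 // subr_eq0 eq_sym.
split; apply: (mulfI c1'); rewrite mulr0.
  have -> : 2 * (1 - c) * C = (1 - c) * (C - (c * C - s * S)) - s * (S - (s * C + c * S)) 
     + (1 - (c ^+ 2 + s ^+ 2)) * C by ring.
  by rewrite -EC -ES cs !subrr; ring.
have -> : 2 * (1 - c) * S = (1 - c) * (S - (s * C + c * S)) + s * (C - (c * C - s * S))
     + (1 - (c ^+ 2 + s ^+ 2)) * S by ring.
by rewrite -EC -ES cs !subrr; ring.
Qed.

(** Either some [phi i] is not a full turn and the sum cancels, or every phase is a full turn and
    each sine is 0. *)
Lemma sum_sin_phase phi : closed_phase phi -> \sum_x sin (phase phi x) = 0.
Proof.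
move=> cphi; have [/existsP[i ci]|/existsPn H] := boolP [exists i, cos (phi i) != 1].
  by have [] := sum_cos_sin_phase cphi ci.
rewrite big1 // => x _; suff [] : full_turn (phase phi x) by [].
apply: big_ind => [||i _]; [exact: full_turn0 | exact: full_turnD|].
apply: full_turnMn; have /eqP ci := negbNE (H i).
have := cos2Dsin2 (phi i); rewrite ci expr1n => /eqP.
by rewrite -subr_eq0 addrAC subrr add0r sqrf_eq0 => /eqP.
Qed.

Definition character_phase k : 'I_r -> R := fun i => 2 * pi * (k i)%:R / (m i)%:R.

Definition hartley_mx : 'M[R]_#|V| :=
  \matrix_(j, l) cas (phase (character_phase (enum_val l)) (enum_val j)).

Lemma torus_eigenvalueE k :
  torus_eigenvalue R k = 2 * r%:R - 2 * \sum_i cos (character_phase k i).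
Proof. by []. Qed.

Hypothesis m_gt0 : forall i, (0 < m i)%N.

Let m_neq0 i : (m i)%:R != 0 :> R.
Proof. by rewrite pnatr_eq0 -lt0n. Qed.

Lemma closed_character_phase k : closed_phase (character_phase k).
Proof.
move=> i; rewrite /character_phase mulfVK //.
exact/full_turnMn/full_turn2pi.
Qed.

(** Orthogonality: a product of two [cas] is the cosine of the difference plus the sine of the sum.
    The sines always cancel, the cosines unless the difference phase is trivial. *)
Lemma sum_casM k l :
  \sum_x cas (phase (character_phase k) x) * cas (phase (character_phase l) x) =
  if k == l then #|V|%:R else 0.
Proof.
pose dif i := character_phase k i - character_phase l i.
pose sum i := character_phase k i + character_phase l i.
have cdif : closed_phase dif.
  move=> i; rewrite mulrBl; apply: full_turnD; last apply: full_turnN;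
    exact: closed_character_phase.
have csum : closed_phase sum.
  by move=> i; rewrite mulrDl; apply: full_turnD; apply: closed_character_phase.
have E x : cas (phase (character_phase k) x) * cas (phase (character_phase l) x) =
    cos (phase dif x) + sin (phase sum x).
  rewrite casM /phase -sumrB -big_split /=; congr (cos _ + sin _);
    by apply: eq_bigr => i _; rewrite ?mulrBl ?mulrDl.
rewrite (eq_bigr _ (fun x _ => E x)) big_split /= sum_sin_phase // addr0.
case: eqVneq => [kl|kl].
  rewrite (eq_bigr (fun=> 1)) ?sumr_const // => x _.
  by rewrite /phase big1 ?cos0 // => i _; rewrite /dif kl subrr mul0r.
have [i kli] : exists i, k i != l i.
  apply/existsP; apply: contraNT kl => /existsPn H.
  by apply/eqP/ffunP => i; apply/eqP; have := H i; rewrite negbK.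
by have [] := sum_cos_sin_phase cdif (i := i) (cos_frac_neq1 _ (ltn_ord _) (ltn_ord _) kli).
Qed.

Lemma det_hartley_mx_neq0 : \det hartley_mx != 0.
Proof.
have H : hartley_mx^T *m hartley_mx = #|V|%:R%:M.
  apply/matrixP => i l; rewrite !mxE -(inj_eq enum_val_inj).
  under eq_bigr do rewrite !mxE.
  rewrite (sum_enum_val (G := torus m) (fun x : V => cas (phase (character_phase (enum_val i)) x) *
    cas (phase (character_phase (enum_val l)) x))) sum_casM.
  by case: eqP.
have /eqP : \det (hartley_mx^T *m hartley_mx) = #|V|%:R ^+ #|V| by rewrite H det_scalar.
rewrite det_mulmx det_tr; apply: contraTneq => ->; rewrite mulr0 eq_sym.
by rewrite expf_eq0 pnatr_eq0; case: #|V|.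
Qed.

Lemma laplacian_hartley :
  L *m hartley_mx = hartley_mx *m diag_mx (\row_l torus_eigenvalue R (enum_val l : V)).
Proof.
apply/matrixP => i l.
rewrite (laplacian_mx_mul (fun j (x : vertex (torus m)) =>
   cas (phase (character_phase (enum_val j)) x)) i l).
rewrite laplacian_cas; last exact: closed_character_phase.
by rewrite mul_mx_diag !mxE mulrC.
Qed.

Definition torus0 : V := [ffun i => Ordinal (m_gt0 i)].

Lemma torus_nonzeroE k : torus_nonzero k = (k != torus0).
Proof.
apply/existsP/idP => [[i ki] | ]; first by apply: contraNneq ki => ->; rewrite ffunE.
apply: contraNP => H; apply/eqP/ffunP => i; apply/val_inj; rewrite ffunE /=.
by apply/eqP; apply: contra_notT H => ki; exists i.
Qed.

Lemma character_phase0 i : character_phase torus0 i = 0.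
Proof. by rewrite /character_phase ffunE /= mulr0 mul0r. Qed.

Lemma torus_eigenvalue0 : torus_eigenvalue R torus0 = 0.
Proof.
rewrite torus_eigenvalueE (eq_bigr (fun=> 1)) => [|i _].
  by rewrite sumr_const card_ord subrr.
by rewrite character_phase0 cos0.
Qed.

Lemma torus_eigenvalue_gt0 k : torus_nonzero k -> 0 < torus_eigenvalue R k.
Proof.
case/existsP => i ki; rewrite torus_eigenvalueE.
have -> : r%:R = \sum_(i < r) 1 :> R by rewrite sumr_const card_ord.
rewrite -mulrBr -sumrB mulr_gt0 // (bigD1 i) //= ltr_pwDl //.
  rewrite subr_gt0 lt_neqAle cos_le1 andbT.
  have := @cos_frac_neq1 R _ 0 (m i) (ltn_ord (k i)) (m_gt0 i) ki.
  by rewrite mulr0 mul0r subr0.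
by apply: sumr_ge0 => j _; rewrite subr_ge0 cos_le1.
Qed.

Lemma char_poly_laplacian_torus :
  char_poly L = 'X * \prod_(k : V | torus_nonzero k) ('X - (torus_eigenvalue R k)%:P).
Proof.
rewrite (char_poly_diagonalized laplacian_hartley det_hartley_mx_neq0).
under eq_bigr do rewrite mxE.
rewrite -(big_enum_val (A := V) (fun k : V => 'X - (torus_eigenvalue R k)%:P)) /=.
rewrite (bigD1 torus0) //= torus_eigenvalue0 subr0; congr (_ * _).
by apply: eq_bigl => k; rewrite torus_nonzeroE.
Qed.

(** By orthogonality to the trivial character, the all-ones matrix kills every column but the
    constant one, so it only replaces the eigenvalue 0 by the number of vertices. *)
Lemma ones_hartley :
  (L + (const_mx 1 : 'rV_#|V|)^T *m const_mx 1) *m hartley_mx =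
  hartley_mx *m diag_mx (\row_l if enum_val l == torus0 then #|V|%:R
                                 else torus_eigenvalue R (enum_val l : V)).
Proof.
rewrite mulmxDl laplacian_hartley; apply/matrixP => i l; rewrite !mul_mx_diag mxE.
rewrite -mulmxA [X in _ + X]mxE big_ord1 !mxE mul1r.
under eq_bigr do rewrite !mxE.
rewrite (sum_enum_val (G := torus m)
  (fun x : V => 1 * cas (phase (character_phase (enum_val l)) x))).
have phase0 x : phase (character_phase torus0) x = 0.
  by rewrite /phase big1 // => j _; rewrite character_phase0 mul0r.
have cas0 : cas (0 : R) = 1 by rewrite /cas cos0 sin0 addr0.
rewrite -[in X in _ + X]cas0.
rewrite [X in _ + X](eq_bigr (fun x => cas (phase (character_phase torus0) x) *
   cas (phase (character_phase (enum_val l)) x))); last by move=> x _; rewrite phase0.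
rewrite sum_casM eq_sym; case: eqP => [->|_]; last by rewrite addr0.
by rewrite torus_eigenvalue0 phase0 cas0 mulr0 add0r mul1r.
Qed.

Lemma tau_torus : #|V|%:R * (tau (torus m))%:R =
  \prod_(k : V | torus_nonzero k) torus_eigenvalue R k.
Proof.
have N0 : #|V|%:R != 0 :> R by rewrite pnatr_eq0 -lt0n; apply/card_gt0P; exists torus0.
apply: (mulfI N0); rewrite mulrA -expr2 -(matrix_tree_ones R (torus0 : vertex (torus m))).
rewrite (det_diagonalized ones_hartley det_hartley_mx_neq0).
under eq_bigr do rewrite mxE.
rewrite -(big_enum_val (A := V) (fun k : V => if k == torus0 then #|V|%:R else torus_eigenvalue R k)) /=.
rewrite (bigD1 torus0) //= eqxx; congr (_ * _).
by apply: eq_big => [k|k /negPf -> //]; rewrite torus_nonzeroE.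
Qed.

End Torus.

(** * Products of cosines *)

Lemma prod_sub_unity_root (F : fieldType) n (z x : F) :
  n.-primitive_root z -> \prod_(j < n) (x - z ^+ j) = x ^+ n - 1.
Proof.
move=> /factor_Xn_sub_1/(congr1 (horner^~ x)).
rewrite horner_prod big_mkord hornerD hornerN hornerXn hornerC => <-.
by apply: eq_bigr => j _; rewrite hornerXsubC.
Qed.

(** Cancelling the factor X - 1 from X^n - 1 leaves 1 + X + ... + X^(n-1), which is evaluated at
    1. *)
Lemma prod_1sub_unity_root (F : fieldType) n (z : F) :
  n.-primitive_root z -> \prod_(j < n | j != 0 :> nat) (1 - z ^+ j) = n%:R.
Proof.
case: n => // n /factor_Xn_sub_1.
rewrite subrX1 big_ltn // expr0 => /(mulfI (negbT (polyXsubC_eq0 1))).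
move/(congr1 (horner^~ 1)); rewrite horner_prod horner_sum big_add1 big_mkord /=.
rewrite [RHS](eq_bigr (fun=> 1)) => [|i _]; last by rewrite hornerXn expr1n.
rewrite sumr_const card_ord => <-; rewrite big_mkcond big_ord_recl /= mul1r.
by apply: eq_bigr => j _; rewrite hornerXsubC.
Qed.

Section CosProduct.
Variable R : realType.
Implicit Types (x y : R) (n : nat).

Definition cis x : R[i] := (cos x +i* sin x)%C.

Lemma cisX x n : cis x ^+ n = cis (x * n%:R).
Proof.
elim: n => [|n IH]; first by rewrite expr0 mulr0 /cis cos0 sin0.
rewrite exprSr IH -natr1 mulrDr mulr1 /cis cosD sinD; congr (_ +i* _)%C.
by rewrite addrC.
Qed.

Lemma prim_root_cis n : (0 < n)%N -> n.-primitive_root (cis (2 * pi / n%:R)).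
Proof.
move=> n0; rewrite /primitive_root_of_unity n0; apply/forallP => -[i lt_in] /=.
have n0R : 0 < n%:R :> R by rewrite ltr0n.
rewrite unity_rootE cisX; apply/eqP; case: (eqVneq i.+1 n) => [->|ni].
  rewrite divfK ?lt0r_neq0 //; apply/eqP.
  by have [] := full_turn2pi R; rewrite /cis => -> ->.
apply/negbTE/negP => /eqP[c _].
suff : cos (2 * pi / n%:R * i.+1%:R) < 1 :> R by rewrite c ltxx.
apply: cos_lt1; first by rewrite mulr_gt0 ?divr_gt0 ?mulr_gt0 ?pi_gt0 ?ltr0n.
rewrite mulrAC ltr_pdivrMr // ltr_pM2l ?mulr_gt0 ?pi_gt0 // ltr_nat.
by rewrite ltn_neqAle ni.
Qed.

(** The squared modulus, with values in [R]: it turns complex factorizations over roots of unity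
    into real products of cosines. *)
Definition sqnormc (w : R[i]) : R := complex.Re w ^+ 2 + complex.Im w ^+ 2.

Lemma sqnormcM : {morph sqnormc : w z / w * z}.
Proof. by move=> [a b] [c d]; rewrite /sqnormc /=; ring. Qed.

Lemma sqnormc_nat n : sqnormc n%:R = n%:R ^+ 2.
Proof. by rewrite -(rmorph_nat (real_complex R)) /sqnormc /= expr0n addr0. Qed.

Lemma sqnormc_prod (I : Type) (s : seq I) (P : pred I) (F : I -> R[i]) :
  sqnormc (\prod_(i <- s | P i) F i) = \prod_(i <- s | P i) sqnormc (F i).
Proof. by apply: (big_morph _ sqnormcM); rewrite (sqnormc_nat 1) expr1n. Qed.

Lemma sqnormc_sub_cis x y : sqnormc (x%:C%C - cis y) = x ^+ 2 - 2 * cos y * x + 1.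
Proof. by rewrite /sqnormc /= sub0r sqrrN -[X in _ = _ + X](cos2Dsin2 y); ring. Qed.

Lemma prod_cos_quadratic n x : (0 < n)%N ->
  \prod_(j < n) (x ^+ 2 - 2 * cos (2 * pi * j%:R / n%:R) * x + 1) = (x ^+ n - 1) ^+ 2.
Proof.
move=> n0; transitivity (sqnormc (x%:C%C ^+ n - 1)); last first.
  by rewrite -rmorphXn /sqnormc /= subr0 expr0n addr0.
rewrite -(prod_sub_unity_root _ (prim_root_cis n0)) sqnormc_prod.
apply: eq_bigr => j _.
by rewrite cisX [in RHS]mulrAC sqnormc_sub_cis.
Qed.

Lemma prod_cos_neq0 n : (0 < n)%N ->
  \prod_(j < n | j != 0 :> nat) (2 - 2 * cos (2 * pi * j%:R / n%:R)) = n%:R ^+ 2 :> R.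
Proof.
move=> n0; rewrite -sqnormc_nat -(prod_1sub_unity_root (prim_root_cis n0)) sqnormc_prod.
apply: eq_bigr => j _.
by rewrite cisX [in RHS]mulrAC (sqnormc_sub_cis 1) expr1n mulr1; ring.
Qed.

Lemma prod_shifted_cos n x : (0 < n)%N -> 0 <= x ->
  \prod_(j < n) (x + (2 - 2 * cos (2 * pi * j%:R / n%:R))) =
  (x / 2 + 1 + Num.sqrt (x ^+ 2 / 4 + x)) ^+ n
  + (x / 2 + 1 - Num.sqrt (x ^+ 2 / 4 + x)) ^+ n - 2.
Proof.
move=> n0 x0; set s := Num.sqrt _.
have s2 : s ^+ 2 = x ^+ 2 / 4 + x by rewrite sqr_sqrtr // addr_ge0 // divr_ge0 // sqr_ge0.
have s0 : 0 <= s by apply: sqrtr_ge0.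
set p := x / 2 + 1 + s; set q := x / 2 + 1 - s.
have pq : p * q = 1 by rewrite mulrC -subr_sqr s2; field.
have p0 : p != 0 by rewrite gt_eqF // /p; lra.
have pqn : p ^+ n * q ^+ n = 1 by rewrite -exprMn pq expr1n.
apply: (mulfI (expf_neq0 n p0)).
transitivity ((p ^+ n - 1) ^+ 2); last first.
  by rewrite mulrBr mulrDr pqn; ring.
rewrite -prod_cos_quadratic //.
(* Since [p + q = x + 2] and [p * q = 1], multiplying a factor by [p] gives the quadratic of
   [prod_cos_quadratic] at [p]. *)
transitivity (\prod_(j < n) (p * (x + (2 - 2 * cos (2 * pi * j%:R / n%:R))))).
  by rewrite big_split prodr_const card_ord.
by apply: eq_bigr => j _; rewrite -[X in _ = _ + X]pq /p /q; field.
Qed.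

End CosProduct.

(** * Splitting off the last coordinate of a torus *)

Section RconsDiag.
Variables (r : nat) (alpha : 'I_r -> nat) (n : nat).
Local Notation beta := (rcons_diag alpha n).

Lemma rcons_diag_lift i : beta (lift ord_max i) = alpha i.
Proof. by rewrite /rcons_diag liftK. Qed.

Lemma rcons_diag_max : beta ord_max = n.
Proof. by rewrite /rcons_diag unlift_none. Qed.

(** Coordinates are joined as plain numbers, which avoids transporting residues along equalities
    between moduli. *)
Definition torus_join_val (k : torus_vertex alpha) (j : 'I_n) (i : 'I_r.+1) : nat :=
  oapp (fun i => k i : nat) j (unlift ord_max i).

Lemma torus_join_subproof k j i : (torus_join_val k j i < beta i)%N.
Proof. by rewrite /torus_join_val /rcons_diag; case: unlift => [i'|] /=. Qed.

Definition torus_join (kj : torus_vertex alpha * 'I_n) : torus_vertex beta :=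
  [ffun i => Ordinal (torus_join_subproof kj.1 kj.2 i)].

Lemma torus_join_lift kj i : torus_join kj (lift ord_max i) = kj.1 i :> nat.
Proof. by rewrite ffunE /= /torus_join_val liftK. Qed.

Lemma torus_join_max kj : torus_join kj ord_max = kj.2 :> nat.
Proof. by rewrite ffunE /= /torus_join_val unlift_none. Qed.

Definition torus_split (K : torus_vertex beta) : torus_vertex alpha * 'I_n :=
  ([ffun i => Ordinal (leq_trans (ltn_ord (K (lift ord_max i))) (eq_leq (rcons_diag_lift i)))],
   Ordinal (leq_trans (ltn_ord (K ord_max)) (eq_leq rcons_diag_max))).

Lemma torus_joinK : cancel torus_join torus_split.
Proof.
move=> [k j]; congr (_, _); last by apply: val_inj; rewrite /= torus_join_max.
by apply/ffunP => i; apply: val_inj; rewrite ffunE /= torus_join_lift.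
Qed.

Lemma torus_splitK : cancel torus_split torus_join.
Proof.
move=> K; apply/ffunP => i; apply: val_inj => /=.
case: (unliftP ord_max i) => [i'|] ->; first by rewrite torus_join_lift ffunE.
by rewrite torus_join_max.
Qed.

Lemma torus_join_bij : bijective torus_join.
Proof. exact: Bijective torus_joinK torus_splitK. Qed.

Lemma torus_nonzero_join kj :
  torus_nonzero (torus_join kj) = torus_nonzero kj.1 || (kj.2 != 0 :> nat).
Proof.
apply/existsP/orP => [[i Ki] | [/existsP[i ki] | j0] ].
- case: (unliftP ord_max i) Ki => [i'|] ->; last by rewrite torus_join_max; right.
  by rewrite torus_join_lift => ki; left; apply/existsP; exists i'.
- by exists (lift ord_max i); rewrite torus_join_lift.
- by exists ord_max; rewrite torus_join_max.
Qed.

Lemma torus_eigenvalue_join (R : realType) kj :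
  torus_eigenvalue R (torus_join kj) =
  torus_eigenvalue R kj.1 + (2 - 2 * cos (2 * pi * kj.2%:R / n%:R)).
Proof.
rewrite /torus_eigenvalue big_ord_recr /= torus_join_max rcons_diag_max.
rewrite (eq_bigr (fun i => cos (2 * pi * (kj.1 i)%:R / (alpha i)%:R))); last first.
  move=> i _; have -> : widen_ord (leqnSn r) i = lift ord_max i.
    by apply: val_inj; rewrite /= /bump leqNgt ltn_ord.
  by rewrite torus_join_lift rcons_diag_lift.
by rewrite -natr1; ring.
Qed.

(** For nonzero [k] every [j] occurs; for [k] zero only nonzero [j] do, and these give the factor
    [n%:R ^+ 2]. *)
Lemma prod_torus_eigenvalue_rcons (R : realType) :
  (forall i, 0 < alpha i)%N -> (0 < n)%N ->
  \prod_(K : torus_vertex beta | torus_nonzero K) torus_eigenvalue R K =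
  n%:R ^+ 2 * \prod_(k : torus_vertex alpha | torus_nonzero k)
    \prod_(j < n) (torus_eigenvalue R k + (2 - 2 * cos (2 * pi * j%:R / n%:R))).
Proof.
move=> alpha_gt0 n0; rewrite (reindex torus_join) /=; last first.
  exact/onW_bij/torus_join_bij.
under eq_bigl do rewrite torus_nonzero_join.
under eq_bigr do rewrite torus_eigenvalue_join.
rewrite -(pair_big_dep xpredT (fun k (j : 'I_n) => torus_nonzero k || (j != 0 :> nat))
  (fun k j => torus_eigenvalue R k + (2 - 2 * cos (2 * pi * j%:R / n%:R)))) /=.
rewrite (bigID (fun k : torus_vertex alpha => torus_nonzero k)) /= mulrC; congr (_ * _).
  rewrite (big_pred1 (torus0 alpha_gt0)); last first.
    by move=> k; rewrite torus_nonzeroE negbK.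
  rewrite torus_eigenvalue0 -(prod_cos_neq0 R n0); apply: eq_big => j.
    by rewrite torus_nonzeroE eqxx.
  by rewrite add0r.
by apply: eq_bigr => k k0; apply: eq_bigl => j; rewrite k0.
Qed.

End RconsDiag.

Lemma card_torus r (m : 'I_r -> nat) : #|torus_vertex m| = (\prod_i m i)%N.
Proof.
rewrite card_dep_ffun foldrE big_map big_enum /=.
by apply: eq_bigr => i _; rewrite card_ord.
Qed.

(** Here [r] stands for d - 1. The first two clauses certify that the [mu k], for nonzero [k], are
    exactly the nonzero Laplacian eigenvalues with multiplicity. *)
Theorem theorem2 (R : realType) (r : nat) (alpha : 'I_r -> nat)
    (alpha_gt0 : forall i, (0 < alpha i)%N) :
  let detA : R := \det (diag_mx (\row_i (alpha i)%:R)) in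
  let mu : torus_vertex alpha -> R := @torus_eigenvalue r alpha R in
  [/\ char_poly (laplacian_mx (torus alpha) R) =
        'X * \prod_(k | torus_nonzero k) ('X - (mu k)%:P),
      forall k, torus_nonzero k -> mu k != 0
    & forall n : nat, (0 < n)%N ->
      (tau (torus (rcons_diag alpha n)))%:R =
        n%:R / detA *
        \prod_(k | torus_nonzero k)
          ((mu k / 2 + 1 + Num.sqrt (mu k ^+ 2 / 4 + mu k)) ^+ n
           + (mu k / 2 + 1 - Num.sqrt (mu k ^+ 2 / 4 + mu k)) ^+ n - 2)].
Proof.
move=> detA mu; split; first exact: char_poly_laplacian_torus.
  by move=> k k0; rewrite gt_eqF // torus_eigenvalue_gt0.
move=> n n0.
have beta_gt0 i : (0 < rcons_diag alpha n i)%N.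
  by rewrite /rcons_diag; case: unlift => /=.
have detAE : detA = (\prod_i alpha i)%N%:R.
  by rewrite /detA det_diag natr_prod; apply: eq_bigr => i _; rewrite mxE.
have detA0 : detA != 0 by rewrite detAE pnatr_eq0 -lt0n prodn_gt0.
have n0R : n%:R != 0 :> R by rewrite pnatr_eq0 -lt0n.
have := tau_torus R beta_gt0; rewrite prod_torus_eigenvalue_rcons //.
rewrite card_torus big_ord_recr /= rcons_diag_max.
under [in X in X%:R * _]eq_bigr => i _.
  rewrite (_ : widen_ord _ i = lift ord_max i) ?rcons_diag_lift; last first.
    by apply: val_inj; rewrite /= /bump leqNgt ltn_ord.
  over.
rewrite natrM -detAE => H.
(* The larger torus has [detA * n%:R] vertices, so both sides are compared after multiplication by
   this number. *)
apply: (mulfI (mulf_neq0 detA0 n0R)); rewrite {}H.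
have cancel_detA Q : detA * n%:R * (n%:R / detA * Q) = n%:R ^+ 2 * Q by field.
rewrite cancel_detA; congr (_ * _).
by apply: eq_bigr => k k0; rewrite prod_shifted_cos // ltW // torus_eigenvalue_gt0.
Qed.
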